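(* If $Q$ and $S$ are profinite quandles, then the product $Q\times S$ is a profinite quandle.
   Context: A quandle $(Q,\triangleleft,\triangleleft^{-1})$ is a set with two binary operations such that for all $x,y,z$: $x\triangleleft x=x$; $(x\triangleleft y)\triangleleft^{-1}y=x=(x\triangleleft^{-1}y)\triangleleft y$; $(x\triangleleft y)\triangleleft z=(x\triangleleft z)\triangleleft(y\triangleleft z)$. A quandle homomorphism is a map preserving $\triangleleft$. The product quandle $Q\times S$ is the product of the underlying sets with $(q_1,s_1)\triangleleft(q_2,s_2):=(q_1\triangleleft_Q q_2,\ s_1\triangleleft_S s_2)$. A directed poset is a partially ordered set in which every pair of elements has an upper bound. An inverse system of quandles over a directed poset $\Lambda$ consists of quandles $Q_\lambda$ and quandle homomorphisms $\varphi_{\alpha\beta}:Q_\beta\to Q_\alpha$ ($\alpha\leq\beta$) with $\varphi_{\alpha\alpha}=\mathrm{id}$ and $\varphi_{\alpha\delta}=\varphi_{\alpha\beta}\circ\varphi_{\beta\delta}$ for $\alpha\le\beta\le\delta$. Its inverse limit is the set of $(q_\lambda)\in\prod Q_\lambda$ with $q_\alpha=\varphi_{\alpha\beta}(q_\beta)$ for all $\alpha\leq\beta$, with coordinatewise operations. A quandle is profinite if it is (isomorphic to) the inverse limit of an inverse system of finite quandles and quandle homomorphisms. *)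

(* Defs.v *)
From HB Require Import structures.
From mathcomp Require Import all_boot all_order.
From mathcomp Require Import boolp classical_sets functions cardinality.

Set Implicit Arguments.
Unset Strict Implicit.
Unset Printing Implicit Defensive.

Local Open Scope order_scope.

HB.mixin Record isQuandle (Q : Type) := {
  qop : Q -> Q -> Q;
  qopV : Q -> Q -> Q;
  qopxx : forall x, qop x x = x;
  qopK : forall x y, qopV (qop x y) y = x;
  qopVK : forall x y, qop (qopV x y) y = x;
  qopDr : forall x y z, qop (qop x y) z = qop (qop x z) (qop y z)
}.

#[short(type="quandleType")]
HB.structure Definition Quandle := {Q of isQuandle Q}.

Notation "x ◁ y" := (qop x y) (at level 40, left associativity).
Notation "x ◁^-1 y" := (qopV x y) (at level 40, left associativity).

Definition quandle_hom (Q S : quandleType) (f : Q -> S) : Prop :=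
  {morph f : x y / x ◁ y}.

Definition quandle_isomorphic (Q S : quandleType) : Prop :=
  exists2 f : Q -> S, quandle_hom f & bijective f.

Lemma quandle_homV (Q S : quandleType) (f : Q -> S) :
  quandle_hom f -> {morph f : x y / x ◁^-1 y}.
Proof. by move=> fM x y; rewrite -{2}(qopVK x y) fM qopK. Qed.

Section Product.
Variables Q S : quandleType.
Implicit Types x y z : Q * S.

Definition prod_qop x y : Q * S := (x.1 ◁ y.1, x.2 ◁ y.2).
Definition prod_qopV x y : Q * S := (x.1 ◁^-1 y.1, x.2 ◁^-1 y.2).

Fact prod_qopxx x : prod_qop x x = x.
Proof. by case: x => q s; rewrite /prod_qop /= !qopxx. Qed.

Fact prod_qopK x y : prod_qopV (prod_qop x y) y = x.
Proof. by case: x => q s; rewrite /prod_qopV /= !qopK. Qed.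

Fact prod_qopVK x y : prod_qop (prod_qopV x y) y = x.
Proof. by case: x => q s; rewrite /prod_qop /= !qopVK. Qed.

Fact prod_qopDr x y z :
  prod_qop (prod_qop x y) z = prod_qop (prod_qop x z) (prod_qop y z).
Proof. by congr pair; apply: qopDr. Qed.

HB.instance Definition _ := isQuandle.Build (Q * S)%type
  prod_qopxx prod_qopK prod_qopVK prod_qopDr.
End Product.

(* The empty poset is allowed; the limit over it is the one-point quandle. *)
Definition directed_poset (d : Order.disp_t) (L : porderType d) : Prop :=
  forall a b : L, exists2 c : L, a <= c & b <= c.

Record inverse_system (d : Order.disp_t) (L : porderType d) := InverseSystem {
  sys_obj :> L -> quandleType;
  sys_map : forall a b : L, a <= b -> sys_obj b -> sys_obj a;
  sys_map_hom : forall (a b : L) (ab : a <= b), quandle_hom (sys_map ab);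
  sys_map_id : forall (a : L) (aa : a <= a) x, sys_map aa x = x;
  sys_map_comp : forall (a b c : L) (ab : a <= b) (bc : b <= c) (ac : a <= c) x,
    sys_map ac x = sys_map ab (sys_map bc x)
}.

Section InverseLimit.
Variables (d : Order.disp_t) (L : porderType d) (F : inverse_system L).

Definition compatible (q : forall a, F a) : Prop :=
  forall (a b : L) (ab : a <= b), q a = sys_map ab (q b).

Definition invlim : Type := {q : forall a, F a | compatible q}.

Implicit Types x y z : invlim.

Lemma invlim_ext x y : (forall a, sval x a = sval y a) -> x = y.
Proof.
move=> xy; apply: eq_sig_hprop => [q p p'|]; first exact: Prop_irrelevance.
exact: functional_extensionality_dep.
Qed.

Fact invlim_qop_subproof x y : compatible (fun a => sval x a ◁ sval y a).
Proof.
by move=> a b ab; rewrite (sys_map_hom ab) -(svalP x _ _ ab) -(svalP y _ _ ab).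
Qed.

Fact invlim_qopV_subproof x y : compatible (fun a => sval x a ◁^-1 sval y a).
Proof.
move=> a b ab; rewrite (quandle_homV (sys_map_hom ab)).
by rewrite -(svalP x _ _ ab) -(svalP y _ _ ab).
Qed.

Definition invlim_qop x y : invlim := exist _ _ (invlim_qop_subproof x y).
Definition invlim_qopV x y : invlim := exist _ _ (invlim_qopV_subproof x y).

Fact invlim_qopxx x : invlim_qop x x = x.
Proof. by apply: invlim_ext => a; apply: qopxx. Qed.

Fact invlim_qopK x y : invlim_qopV (invlim_qop x y) y = x.
Proof. by apply: invlim_ext => a; apply: qopK. Qed.

Fact invlim_qopVK x y : invlim_qop (invlim_qopV x y) y = x.
Proof. by apply: invlim_ext => a; apply: qopVK. Qed.

Fact invlim_qopDr x y z :
  invlim_qop (invlim_qop x y) z = invlim_qop (invlim_qop x z) (invlim_qop y z).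
Proof. by apply: invlim_ext => a; apply: qopDr. Qed.

HB.instance Definition _ := isQuandle.Build invlim
  invlim_qopxx invlim_qopK invlim_qopVK invlim_qopDr.
End InverseLimit.

(* Purely algebraic: no topology is part of the definition. *)
Definition profinite (Q : quandleType) : Prop :=
  exists (d : Order.disp_t) (L : porderType d) (F : inverse_system L),
    [/\ directed_poset L,
        forall a, finite_set [set: F a]%classic &
        quandle_isomorphic Q (invlim F)].

(* Main.v *)
(** The product of the two inverse systems, indexed by the product poset, has
the product of the two limits as its limit.  A compatible family [z] over the
product poset is recovered from the slices through fixed base points [a0] and
[b0], because by directedness the first component of [z (a, b)] does not depend
on [b] (compare both values with an upper bound).  Base points exist after
replacing an empty index poset, whose limit is a single point, by a one-point
poset. *)
Require Import Defs.
From HB Require Import structures.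
From mathcomp Require Import all_boot all_order.
From mathcomp Require Import boolp classical_sets functions cardinality.

Set Implicit Arguments.
Unset Strict Implicit.
Unset Printing Implicit Defensive.

Import Order.Theory.
Local Open Scope order_scope.

Lemma quandle_isomorphic_trans (Q S T : quandleType) :
  quandle_isomorphic Q S -> quandle_isomorphic S T -> quandle_isomorphic Q T.
Proof.
move=> [f fM fB] [g gM gB]; exists (g \o f); last exact: bij_comp.
by move=> x y /=; rewrite fM gM.
Qed.

Lemma quandle_isomorphic_prod (Q Q' S S' : quandleType) :
  quandle_isomorphic Q Q' -> quandle_isomorphic S S' ->
  quandle_isomorphic (Q * S)%type (Q' * S')%type.
Proof.
move=> [f fM [f' fK f'K]] [g gM [g' gK g'K]].
exists (fun x => (f x.1, g x.2)) => [x y|].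
  exact: congr2 (fM x.1 y.1) (gM x.2 y.2).
exists (fun x => (f' x.1, g' x.2)) => -[x y] /=; first by rewrite fK gK.
by rewrite f'K g'K.
Qed.

Section ConstantSystem.
Variables (d : Order.disp_t) (L : porderType d) (Q : quandleType).

Definition const_system : inverse_system L :=
  @InverseSystem d L (fun=> Q) (fun _ _ _ => id)
    (fun _ _ _ _ _ => erefl) (fun _ _ _ => erefl) (fun _ _ _ _ _ _ _ => erefl).

(** Directedness forces a compatible family to be constant: its values at [a] and [a0] both equal
    its value at a common upper bound. Evaluation at [a0] is therefore inverse to the diagonal
    map. *)
Lemma invlim_const (a0 : L) :
  directed_poset L -> quandle_isomorphic Q (invlim const_system).
Proof.
move=> dirL.
have cst_compat (q : Q) : compatible (F := const_system) (fun=> q) by [].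
exists (fun q => exist _ _ (cst_compat q)) => [x y|].
  exact: invlim_ext.
exists (fun z => sval z a0) => // z; apply: invlim_ext => a /=.
have [c ac a0c] := dirL a a0.
by rewrite (svalP z _ _ ac) (svalP z _ _ a0c).
Qed.

End ConstantSystem.

(** Supplies the base points for the slices in [invlim_prod]. *)
Lemma profinite_inhabited (Q : quandleType) : profinite Q ->
  exists (d : Order.disp_t) (L : porderType d) (F : inverse_system L),
    [/\ inhabited L, directed_poset L,
        forall a, finite_set [set: F a]%classic &
        quandle_isomorphic Q (invlim F)].
Proof.
move=> [d [L [F [dirL finF isoQ]]]].
have [inL|noL] := pselect (inhabited L); first by exists d, L, F.
have dir1 : directed_poset 'I_1 by move=> a b; exists ord0; rewrite ord1.
exists _, 'I_1, (const_system 'I_1 Q); split=> //.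
- exact: inhabits ord0.
(* The one-point system has [Q] itself as its object, so [Q] must be finite. Over an empty [L] any
   two families agree vacuously, and injectivity of [f] leaves at most one element in [Q]. *)
- move=> i; have [f _ /bij_inj injf] := isoQ.
  have Q1 (x y : Q) : x = y.
    by apply/injf/invlim_ext => a; case: noL; exact: inhabits a.
  have [[q]|noQ] := pselect (inhabited Q).
    by apply: sub_finite_set (finite_set1 q) => x _; exact: Q1.
  by apply: sub_finite_set (finite_set0 _) => x _; case: noQ; exact: inhabits x.
- exact: invlim_const ord0 dir1.
Qed.

Section ProductSystem.
Variables (d d' : Order.disp_t) (L : porderType d) (M : porderType d').
Variables (F : inverse_system L) (G : inverse_system M).

(** The order on [L *p M] is componentwise and unfolds to a boolean conjunction. *)
Let le1 (p q : L *p M) (pq : p <= q) : p.1 <= q.1 := proj1 (andP pq).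
Let le2 (p q : L *p M) (pq : p <= q) : p.2 <= q.2 := proj2 (andP pq).

Definition prod_map (p q : L *p M) (pq : p <= q) (x : F q.1 * G q.2) :
  F p.1 * G p.2 := (sys_map (le1 pq) x.1, sys_map (le2 pq) x.2).

Fact prod_map_hom (p q : L *p M) (pq : p <= q) :
  quandle_hom (prod_map pq : (F q.1 * G q.2)%type -> (F p.1 * G p.2)%type).
Proof.
move=> x y; exact: congr2 (sys_map_hom _ x.1 y.1) (sys_map_hom _ x.2 y.2).
Qed.

Fact prod_map_id (p : L *p M) (pp : p <= p) x : prod_map pp x = x.
Proof. by case: x => x y; rewrite /prod_map !sys_map_id. Qed.

Fact prod_map_comp (p q r : L *p M) (pq : p <= q) (qr : q <= r) (pr : p <= r) x :
  prod_map pr x = prod_map pq (prod_map qr x).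
Proof. by congr pair; apply: sys_map_comp. Qed.

Definition prod_system : inverse_system (L *p M) :=
  InverseSystem prod_map_hom prod_map_id prod_map_comp.

Lemma directed_poset_prod :
  directed_poset L -> directed_poset M -> directed_poset (L *p M).
Proof.
move=> dirL dirM [a b] [a' b'].
have [c ac a'c] := dirL a a'; have [e be b'e] := dirM b b'.
by exists (c, e); apply/andP.
Qed.

Section Limit.
Hypotheses (dirL : directed_poset L) (dirM : directed_poset M).
Variables (a0 : L) (b0 : M).

Fact prod_compatible (x : invlim F) (y : invlim G) :
  compatible (F := prod_system) (fun p => (sval x p.1, sval y p.2)).
Proof.
move=> p q pq; exact: congr2 (svalP x _ _ (le1 pq)) (svalP y _ _ (le2 pq)).
Qed.

Let le_l (a a' : L) (b : M) (aa' : a <= a') : ((a, b) : L *p M) <= (a', b).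
Proof. exact/andP. Qed.

Let le_r (a : L) (b b' : M) (bb' : b <= b') : ((a, b) : L *p M) <= (a, b').
Proof. exact/andP. Qed.

Fact fst_compatible (z : invlim prod_system) :
  compatible (F := F) (fun a => (sval z (a, b0)).1).
Proof.
move=> a a' aa'; rewrite (svalP z _ _ (le_l b0 aa')) /=.
(* The two sides differ only in the proof of [a <= a']: one is extracted from the comparison of
   pairs, the other is [aa']. *)
by congr sys_map; apply: Prop_irrelevance.
Qed.

Fact snd_compatible (z : invlim prod_system) :
  compatible (F := G) (fun b => (sval z (a0, b)).2).
Proof.
move=> b b' bb'; rewrite (svalP z _ _ (le_r a0 bb')) /=.
by congr sys_map; apply: Prop_irrelevance.
Qed.

Lemma fst_invlim_prod (z : invlim prod_system) a b b' :
  (sval z (a, b)).1 = (sval z (a, b')).1.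
Proof.
have [c bc b'c] := dirM b b'.
(* Along [le_r] the first index stays at [a], so the transition map is the identity on first
   components. *)
by rewrite (svalP z _ _ (le_r a bc)) (svalP z _ _ (le_r a b'c)) /= !sys_map_id.
Qed.

Lemma snd_invlim_prod (z : invlim prod_system) a a' b :
  (sval z (a, b)).2 = (sval z (a', b)).2.
Proof.
have [c ac a'c] := dirL a a'.
by rewrite (svalP z _ _ (le_l b ac)) (svalP z _ _ (le_l b a'c)) /= !sys_map_id.
Qed.

Lemma invlim_prod :
  quandle_isomorphic (invlim F * invlim G)%type (invlim prod_system).
Proof.
exists (fun x => exist _ _ (prod_compatible x.1 x.2)) => [x y|].
  exact: invlim_ext.
exists (fun z => (exist _ _ (fst_compatible z), exist _ _ (snd_compatible z))).
  by move=> [x y]; congr pair; apply: invlim_ext.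
move=> z; apply: invlim_ext => -[a b] /=.
(* The components read on the slices at [b0] and [a0] are both moved to the index [(a, b)]. *)
rewrite (fst_invlim_prod z a b0 b) (snd_invlim_prod z a0 a b).
by rewrite -surjective_pairing.
Qed.

End Limit.
End ProductSystem.

Theorem proposition3p19 (Q S : quandleType) (hQ : profinite Q)
  (hS : profinite S) : profinite (Q * S)%type.
Proof.
have [d [L [F [[a0] dirL finF isoQ]]]] := profinite_inhabited hQ.
have [d' [M [G [[b0] dirM finG isoS]]]] := profinite_inhabited hS.
exists _, (L *p M)%type, (prod_system F G); split.
- exact: directed_poset_prod.
(* The full set of a product type is the product of the full sets. *)
- by move=> [a b]; rewrite -setXTT; apply: finite_setX.
- apply: quandle_isomorphic_trans (quandle_isomorphic_prod isoQ isoS) _.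
  exact: invlim_prod.
Qed.
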